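(* Let $\mathcal{K}_\succ$ be a prioritized knowledge base with $\mathcal{K}=(\mathcal{D},\mathcal{T})$, let $X\in\{P,G,C\}$, let $\mathcal{B}\subseteq\mathcal{D}$, let $\mathcal{B}_r=\mathrm{R}_\mathrm{w}(\mathcal{B})$, let $\mathcal{K}^{\mathcal{B}_r}=(\mathcal{B}_r,\mathcal{T})$, and let $\succ^{\mathcal{B}_r}$ be the restriction of $\succ$ to $\mathcal{B}_r$. Then: (1) if $\mathcal{R}\in X\text{Rep}(\mathcal{K}_\succ)$, then $\mathcal{R}\cap\mathcal{B}_r\in X\text{Rep}(\mathcal{K}^{\mathcal{B}_r}_{\succ^{\mathcal{B}_r}})$; (2) if $\mathcal{R}\in X\text{Rep}(\mathcal{K}^{\mathcal{B}_r}_{\succ^{\mathcal{B}_r}})$, then there exists $\mathcal{R}'\in X\text{Rep}(\mathcal{K}_\succ)$ such that $\mathcal{R}=\mathcal{R}'\cap\mathcal{B}_r$.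
   Context: A knowledge base (KB) is a pair $\mathcal{K}=(\mathcal{D},\mathcal{T})$ where $\mathcal{D}$ is a finite set of ground facts $P(c_1,\dots,c_n)$ and $\mathcal{T}$ is a finite set of first-order sentences. A set $\mathcal{S}\subseteq\mathcal{D}$ is $\mathcal{T}$-consistent if $\mathcal{S}\cup\mathcal{T}$ has a model. A conflict of $\mathcal{K}$ is an inclusion-minimal $\mathcal{C}\subseteq\mathcal{D}$ that is not $\mathcal{T}$-consistent; the set of conflicts is $\mathrm{Conf}(\mathcal{K})$. A (subset) repair of $\mathcal{K}$ is an inclusion-maximal $\mathcal{T}$-consistent subset of $\mathcal{D}$. A priority relation $\succ$ for $\mathcal{K}$ is an acyclic binary relation on $\mathcal{D}$ such that $\alpha\succ\beta$ implies $\{\alpha,\beta\}\subseteq\mathcal{C}$ for some $\mathcal{C}\in\mathrm{Conf}(\mathcal{K})$; it is total if for all distinct $\alpha,\beta$ lying together in some conflict, $\alpha\succ\beta$ or $\beta\succ\alpha$. A completion of $\succ$ is a total priority relation $\succ'\supseteq\succ$. A prioritized KB $\mathcal{K}_\succ$ is a KB with a priority relation for it. For a repair $\mathcal{R}$ of $\mathcal{K}$: a Pareto improvement of $\mathcal{R}$ is a $\mathcal{T}$-consistent $\mathcal{B}'\subseteq\mathcal{D}$ such that some $\beta\in\mathcal{B}'\setminus\mathcal{R}$ satisfies $\beta\succ\alpha$ for every $\alpha\in\mathcal{R}\setminus\mathcal{B}'$; a global improvement of $\mathcal{R}$ is a $\mathcal{T}$-consistent $\mathcal{B}'\subseteq\mathcal{D}$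 with $\mathcal{B}'\neq\mathcal{R}$ such that for every $\alpha\in\mathcal{R}\setminus\mathcal{B}'$ there is $\beta\in\mathcal{B}'\setminus\mathcal{R}$ with $\beta\succ\alpha$. $\mathcal{R}$ is Pareto-optimal if it has no Pareto improvement, globally-optimal if it has no global improvement, and completion-optimal if it is a globally-optimal repair of $\mathcal{K}_{\succ'}$ for some completion $\succ'$ of $\succ$. $P\text{Rep}(\mathcal{K}_\succ)$, $G\text{Rep}(\mathcal{K}_\succ)$, $C\text{Rep}(\mathcal{K}_\succ)$ denote the sets of Pareto-, globally- and completion-optimal repairs, respectively. Reachability: in a directed hypergraph with edges of the form $(\alpha,\mathcal{E})$ ($\alpha$ a node, $\mathcal{E}$ a set of nodes), a node $\gamma$ is reachable from a set of nodes $\mathcal{B}$ if $\gamma\in\mathcal{B}$ or there is a node $\beta$ reachable from $\mathcal{B}$ and an edge $(\beta,\mathcal{E})$ with $\gamma\in\mathcal{E}$. $\mathrm{R}_\mathrm{w}(\mathcal{B})$ is the set of facts reachable from $\mathcal{B}$ in the directed hypergraph on $\mathcal{D}$ whose edges are $\{(\alpha,\mathcal{E})\mid \mathcal{E}\cup\{\alpha\}\in\mathrm{Conf}(\mathcal{K}),\ \alpha\notin\mathcal{E},\ \exists\beta\in\mathcal{E},\ \alpha\not\succ\beta\}$. *)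

(* Defs.v *)
From HB Require Import structures.
From mathcomp Require Import all_boot boolp classical_sets functions cardinality.
From Stdlib Require Import Relation_Operators.

Set Implicit Arguments.
Unset Strict Implicit.
Unset Printing Implicit Defensive.

Local Open Scope classical_set_scope.

(* No finiteness is imposed on the signature; a function-free vocabulary is
   the case where [func] is empty. *)
Record signature := Signature {
  const : Type;
  func : Type;
  func_arity : func -> nat;
  pred_sym : Type;
  pred_arity : pred_sym -> nat
}.

(* De Bruijn representation: the index [n] bounds the free variables, and a
   quantifier binds variable [ord0] of its body. *)
Inductive term (Sg : signature) (n : nat) : Type :=
| Var of 'I_n
| Const of const Sg
| App (f : func Sg) of {ffun 'I_(func_arity f) -> term Sg n}.

Inductive formula (Sg : signature) : nat -> Type :=
| Bot n : formula Sg n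
| Eq n of term Sg n & term Sg n : formula Sg n
| Atom n (P : pred_sym Sg) of {ffun 'I_(pred_arity P) -> term Sg n} :
    formula Sg n
| Neg n of formula Sg n : formula Sg n
| And n of formula Sg n & formula Sg n : formula Sg n
| Or n of formula Sg n & formula Sg n : formula Sg n
| Imp n of formula Sg n & formula Sg n : formula Sg n
| All n of formula Sg n.+1 : formula Sg n
| Ex n of formula Sg n.+1 : formula Sg n.

Definition sentence (Sg : signature) := formula Sg 0.

Record fact (Sg : signature) := Fact {
  fact_pred : pred_sym Sg;
  fact_args : {ffun 'I_(pred_arity fact_pred) -> const Sg}
}.

(* [point] makes the domain nonempty. Distinct constants may denote the same
   element. *)
Record structure (Sg : signature) := Structure {
  dom : Type;
  point : dom;
  int_const : const Sg -> dom;
  int_func : forall f : func Sg, {ffun 'I_(func_arity f) -> dom} -> dom;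
  int_pred : forall P : pred_sym Sg, {ffun 'I_(pred_arity P) -> dom} -> Prop
}.

Section Semantics.
Variables (Sg : signature) (M : structure Sg).

Fixpoint eval n (e : 'I_n -> dom M) (t : term Sg n) : dom M :=
  match t with
  | Var i => e i
  | Const c => int_const M c
  | App f ts => @int_func Sg M f [ffun i => eval e (ts i)]
  end.

Definition env_cons n (d : dom M) (e : 'I_n -> dom M) : 'I_n.+1 -> dom M :=
  fun i => if unlift ord0 i is Some j then e j else d.

Fixpoint sat n (phi : formula Sg n) : ('I_n -> dom M) -> Prop :=
  match phi in formula _ m return ('I_m -> dom M) -> Prop with
  | Bot _ => fun _ => False
  | Eq _ t u => fun e => eval e t = eval e u
  | Atom _ P ts => fun e => @int_pred Sg M P [ffun i => eval e (ts i)]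
  | Neg _ p => fun e => ~ sat p e
  | And _ p q => fun e => sat p e /\ sat q e
  | Or _ p q => fun e => sat p e \/ sat q e
  | Imp _ p q => fun e => sat p e -> sat q e
  | All _ p => fun e => forall d, sat p (env_cons d e)
  | Ex _ p => fun e => exists d, sat p (env_cons d e)
  end.

Definition sat_sentence (phi : sentence Sg) : Prop :=
  forall e : 'I_0 -> dom M, sat phi e.

Definition sat_fact (a : fact Sg) : Prop :=
  @int_pred Sg M (fact_pred a) [ffun i => int_const M (fact_args a i)].

End Semantics.

Section KnowledgeBase.
Variable Sg : signature.
Implicit Types (D S C R B : set (fact Sg)) (T : set (sentence Sg)).
Implicit Types (pr : fact Sg -> fact Sg -> Prop).

Definition knowledge_base D T : Prop := finite_set D /\ finite_set T.

Definition consistent T S : Prop :=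
  exists M : structure Sg,
    (forall a, S a -> sat_fact M a) /\ (forall phi, T phi -> sat_sentence M phi).

Definition conflict D T C : Prop :=
  [/\ C `<=` D, ~ consistent T C
    & forall C', C' `<=` C -> ~ consistent T C' -> C' = C].

Definition repair D T R : Prop :=
  [/\ R `<=` D, consistent T R
    & forall R', R' `<=` D -> consistent T R' -> R `<=` R' -> R' = R].

Definition acyclic pr : Prop := forall a, ~ clos_trans (fact Sg) pr a a.

(* Conflicts are subsets of [D], so a priority relation relates only facts
   of [D]. *)
Definition priority_relation D T pr : Prop :=
  acyclic pr /\
  forall a b, pr a b -> exists C, [/\ conflict D T C, C a & C b].

Definition total_priority D T pr : Prop :=
  forall a b, a <> b -> (exists C, [/\ conflict D T C, C a & C b]) ->
    pr a b \/ pr b a.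

Definition completion D T pr pr' : Prop :=
  [/\ priority_relation D T pr', total_priority D T pr'
    & forall a b, pr a b -> pr' a b].

Definition prioritized_kb D T pr : Prop :=
  knowledge_base D T /\ priority_relation D T pr.

Definition pareto_improvement D T pr R B : Prop :=
  [/\ B `<=` D, consistent T B
    & exists b, (B `\` R) b /\ forall a, (R `\` B) a -> pr b a].

Definition global_improvement D T pr R B : Prop :=
  [/\ B `<=` D, consistent T B, B <> R
    & forall a, (R `\` B) a -> exists b, (B `\` R) b /\ pr b a].

Definition PRep D T pr R : Prop :=
  repair D T R /\ ~ exists B, pareto_improvement D T pr R B.

Definition GRep D T pr R : Prop :=
  repair D T R /\ ~ exists B, global_improvement D T pr R B.

Definition CRep D T pr R : Prop :=
  exists pr', completion D T pr pr' /\ GRep D T pr' R.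

Inductive optimality := Pareto | Global | Completion.

Definition XRep (X : optimality) :=
  match X with Pareto => PRep | Global => GRep | Completion => CRep end.

Definition restrict_rel B pr : fact Sg -> fact Sg -> Prop :=
  fun a b => [/\ B a, B b & pr a b].

End KnowledgeBase.

Inductive reachable (V : Type) (H : set (V * set V)) (B : set V) : set V :=
| reachable_base v : B v -> reachable H B v
| reachable_step v (E : set V) w :
    reachable H B v -> H (v, E) -> E w -> reachable H B w.

Definition weak_edges (Sg : signature) (D : set (fact Sg))
    (T : set (sentence Sg)) (pr : fact Sg -> fact Sg -> Prop) :
    set (fact Sg * set (fact Sg)) :=
  [set e | [/\ conflict D T (e.2 `|` [set e.1]), ~ e.2 e.1
             & exists b, e.2 b /\ ~ pr e.1 b]].

Definition Rw (Sg : signature) (D : set (fact Sg)) (T : set (sentence Sg))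
    (pr : fact Sg -> fact Sg -> Prop) (B : set (fact Sg)) : set (fact Sg) :=
  reachable (weak_edges D T pr) B.

(* The restriction of a prioritized knowledge base to a set [Rw D T pr B] is
   again a prioritized knowledge base; for an arbitrary set of facts the
   restricted relation may relate facts that no longer share a conflict. *)

Lemma Rw_sub (Sg : signature) (D : set (fact Sg)) (T : set (sentence Sg)) pr
    (B : set (fact Sg)) : B `<=` D -> Rw D T pr B `<=` D.
Proof.
move=> BD a; elim=> [v /BD//|v E w _ _ [/= [CD _ _] _ _] Ew].
by apply: CD; left.
Qed.

Lemma Rw_conflict (Sg : signature) (D : set (fact Sg)) (T : set (sentence Sg))
    pr (B C : set (fact Sg)) a :
  conflict D T C -> C a -> Rw D T pr B a ->
  (exists b, [/\ C b, b <> a & ~ pr a b]) -> C `<=` Rw D T pr B.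
Proof.
move=> cC Ca Ba [b [Cb ba nab]] x Cx.
have [->//|xa] := EM (x = a).
apply: (@reachable_step _ _ _ a (C `\ a)) => //.
split=> /=; last by exists b.
  have -> // : C `\ a `|` [set a] = C.
  apply/seteqP; split=> [y [[]//|->//]|y Cy].
  by have [->|ya] := EM (y = a); [right|left].
by case=> _ /(_ erefl).
Qed.

Lemma prioritized_kb_Rw (Sg : signature) (D : set (fact Sg))
    (T : set (sentence Sg)) pr (B : set (fact Sg)) :
  prioritized_kb D T pr -> B `<=` D ->
  prioritized_kb (Rw D T pr B) T (restrict_rel (Rw D T pr B) pr).
Proof.
move=> [[fD fT] [acy prC]] BD.
split; first by split=> //; exact: sub_finite_set (Rw_sub BD) fD.
split=> [a|a b [Ba Bb ab]].
  suff sub x y : clos_trans _ (restrict_rel (Rw D T pr B) pr) x y ->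
    clos_trans _ pr x y by move/sub; exact: acy.
  elim=> {x y} [x y [_ _ xy]|x y z _ xy _ yz]; first exact: t_step.
  exact: t_trans xy yz.
have [C [cC Ca Cb]] := prC _ _ ab; exists C; split=> //.
have [_ nC mC] := cC; split=> //.
have nba : ~ pr b a.
  move=> ba; apply: (acy a).
  exact: t_trans (t_step _ _ _ _ ab) (t_step _ _ _ _ ba).
apply: (Rw_conflict cC Cb Bb); exists a; split=> // eab.
by apply: (acy a); apply: t_step; move: ab; rewrite -eab.
Qed.

(* Main.v *)
Require Import Defs.
From mathcomp Require Import all_boot boolp classical_sets functions cardinality.
From mathcomp Require Import zify.
From Stdlib Require Import Relation_Operators.

Set Implicit Arguments.
Unset Strict Implicit.
Unset Printing Implicit Defensive.

Local Open Scope classical_set_scope.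

(** A conflict that meets [Rw D T pr B] in [a] without being included in it is
    dominated by [a], so no priority enters [Rw D T pr B] from outside.  Hence an
    improvement [P] of [R `&` Rw D T pr B] turns into an improvement of [R] by
    adding to [P] the facts of [R] outside [Rw D T pr B] not dominated by the
    facts that [P] brings in.  In the other direction, an optimal repair of the
    restricted knowledge base is extended greedily by the outer facts, taken in
    an order that refines the priority; for completions, this requires first to
    merge a completion of the restriction with the priority on the whole. *)

(** * Finite sets and ranks refining an acyclic relation *)

Lemma finite_set_induction (U : Type) (P : set U -> Prop) :
  P set0 ->
  (forall x A, finite_set A -> ~ A x -> P A -> P (x |` A)) ->
  forall A, finite_set A -> P A.
Proof.
move=> P0 PU A /(@finite_seqP {classic U})[s ->].
elim: s => [|x s IHs]; first by rewrite set_nil.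
have [xs|xs] := boolP (x \in s).
  suff -> : [set` x :: s] = [set` s] by [].
  apply/seteqP; split=> y /=; last by rewrite inE => ->; rewrite orbT.
  by rewrite inE => /orP[/eqP ->|].
suff -> : [set` x :: s] = x |` [set` s].
  apply: PU => //; last exact/negP.
  by apply/(@finite_seqP {classic U}); exists s.
apply/seteqP; split=> y /=; rewrite inE.
  by case/orP=> [/eqP|]; [left|right].
by case=> [->|->]; rewrite ?eqxx ?orbT.
Qed.

Lemma acyclic_rank (Sg : signature) (q : fact Sg -> fact Sg -> Prop)
    (D : set (fact Sg)) :
  acyclic q -> finite_set D ->
  exists f : fact Sg -> nat, exists N : nat,
    [/\ forall a, D a -> f a < N,
        forall a b, D a -> D b -> f a = f b -> a = b
      & forall a b, D a -> D b -> q a b -> f a < f b].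
Proof.
move=> qac fD.
suff [f [N [fN finj fq]]] : exists f : fact Sg -> nat, exists N : nat,
    [/\ forall a, D a -> f a < N,
        forall a b, D a -> D b -> f a = f b -> a = b
      & forall a b, D a -> D b -> clos_trans _ q a b -> f a < f b].
  exists f, N; split=> // a b Da Db ab; apply: fq => //; exact: t_step.
elim/finite_set_induction: D / fD => [|x A _ Ax [f [N [fN finj fq]]]].
  by exists (fun=> 0), 0; split.
(* [x] takes the rank [N], above the facts of [A] lying below it in the order; all other facts of
   [A] are shifted past [N]. *)
pose g y := if `[< y = x >] then N
            else if `[< clos_trans _ q y x >] then f y else N.+1 + f y.
have gx : g x = N by rewrite /g asboolT.
have gA y : A y -> clos_trans _ q y x /\ g y = f y \/
                   ~ clos_trans _ q y x /\ g y = N.+1 + f y.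
  move=> Ay; rewrite /g asboolF => [|yx]; last by apply: Ax; rewrite -yx.
  by have [yx|yx] := EM (clos_trans _ q y x); [left; rewrite asboolT|
     right; rewrite asboolF].
exists g, (N.+1 + N); split.
- move=> a [->|/[dup] /fN fa /gA]; first by rewrite gx; lia.
  by case=> -[_ ->]; lia.
- move=> a b [->|Aa] [->|Ab] //; rewrite ?gx.
  + by have fb := fN _ Ab; case: (gA _ Ab) => -[_ ->]; lia.
  + by have fa := fN _ Aa; case: (gA _ Aa) => -[_ ->]; lia.
  + move=> gab; apply: finj => //; move: gab (fN _ Aa) (fN _ Ab).
    by case: (gA _ Aa) => -[_ ->]; case: (gA _ Ab) => -[_ ->]; lia.
- move=> a b [->|Aa] [->|Ab] ab; rewrite ?gx.
  + by case: (qac x).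
  + case: (gA _ Ab) => -[bx ->]; last by lia.
    by case: (qac x); exact: t_trans ab bx.
  + by have fa := fN _ Aa; case: (gA _ Aa) => -[ax ->] //.
  + have := fq _ _ Aa Ab ab; have := fN _ Aa.
    case: (gA _ Aa) => -[ax ->]; case: (gA _ Ab) => -[bx ->]; try lia.
    by case: ax; exact: t_trans ab bx.
Qed.

(** * Consistency, conflicts, and criteria for optimality *)

Section KnowledgeBaseTheory.
Context {Sg : signature} {T : set (sentence Sg)}.
Implicit Types (A B C D P R S : set (fact Sg)).
Implicit Types pr : fact Sg -> fact Sg -> Prop.

Lemma consistent_sub {S S'} : S `<=` S' -> consistent T S' -> consistent T S.
Proof. by move=> SS' [M [MS MT]]; exists M; split=> // a /SS' /MS. Qed.

(* [K] accumulates the facts that the induction on [F] must keep. *)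
Lemma inconsistent_minimal F K : finite_set F -> ~ consistent T (K `|` F) ->
  exists G, [/\ G `<=` F, ~ consistent T (K `|` G)
              & forall x, G x -> consistent T ((K `|` G) `\ x)].
Proof.
move=> fF; elim/finite_set_induction: F / fF K => [|x F _ Fx IH] K.
  by exists set0; split.
move=> nKxF; have [cKF|/IH[G [GF nG mG]]] := EM (consistent T (K `|` F)).
  have [|G [GF nG mG]] := IH (K `|` [set x]).
    by apply: contra_not nKxF; apply: consistent_sub => y /=; tauto.
  exists (x |` G); split=> [y [->|/GF]||y]; [by left|by right| |].
    by rewrite setUA.
  case=> [->|Gy].
    apply: consistent_sub cKF => z /= [[Kz|[zx|/GF]]]; by [left|right|].
  by rewrite setUA; exact: mG.
by exists G; split=> // y /GF; right.
Qed.

Lemma conflict_exists D S : finite_set D -> S `<=` D -> ~ consistent T S ->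
  exists C, conflict D T C /\ C `<=` S.
Proof.
move=> fD SD nS; have fS := sub_finite_set SD fD.
have [|C] := @inconsistent_minimal S set0 fS.
  by rewrite set0U.
rewrite set0U => -[CS nC mC]; exists C; split=> //; split=> // [x /CS /SD//|].
move=> C' C'C nC'; apply/seteqP; split=> // x Cx; apply: contrapT => C'x.
apply: nC'; apply: consistent_sub (mC _ Cx) => y C'y; split; first exact: C'C.
by move=> yx; apply: C'x; rewrite -yx.
Qed.

(** A consistent proper superset loses no fact, hence is a Pareto improvement: maximality comes for
    free. The same holds for global improvements. *)
Lemma PRepE {D pr R} : PRep D T pr R <->
  [/\ R `<=` D, consistent T R & ~ exists P, pareto_improvement D T pr R P].
Proof.
split=> [[[RD cR _] nI]//|[RD cR nI]]; split=> //; split=> // R' R'D cR' RR'.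
apply/seteqP; split=> // a R'a; apply: contrapT => Ra; apply: nI.
by exists R'; split=> //; exists a; split=> // b [/RR'].
Qed.

Lemma GRepE {D pr R} : GRep D T pr R <->
  [/\ R `<=` D, consistent T R & ~ exists P, global_improvement D T pr R P].
Proof.
split=> [[[RD cR _] nI]//|[RD cR nI]]; split=> //; split=> // R' R'D cR' RR'.
by apply: contrapT => R'R; apply: nI; exists R'; split=> // b [/RR'].
Qed.

(** Apart from inclusion in [D], the only property of [Rw] used below. It persists when [pr] is
    enlarged, as completions require. *)
Definition dominates_crossing D pr A := forall C a,
  conflict D T C -> C a -> A a ->
  C `<=` A \/ forall b, C b -> b <> a -> pr a b.

Lemma Rw_dominates_crossing D pr B : dominates_crossing D pr (Rw D T pr B).
Proof.
move=> C a cC Ca Ba; have [h|h] := EM (forall b, C b -> b <> a -> pr a b).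
  by right.
left; apply: Rw_conflict cC Ca Ba _; apply: contrapT => nex; apply: h => b Cb ba.
by apply: contrapT => nab; apply: nex; exists b.
Qed.

Lemma dominates_crossingS D pr pr' A : (forall a b, pr a b -> pr' a b) ->
  dominates_crossing D pr A -> dominates_crossing D pr' A.
Proof.
move=> prS dA C a cC Ca Aa; have [|h] := dA _ _ cC Ca Aa; first by left.
by right=> b Cb /(h _ Cb) /prS.
Qed.

Lemma acyclic_asym pr a b : acyclic pr -> pr a b -> ~ pr b a.
Proof.
by move=> ac ab ba; apply: (ac a); apply: t_trans; apply: t_step; eassumption.
Qed.

Lemma acyclic_sub pr pr' : (forall a b, pr' a b -> pr a b) ->
  acyclic pr -> acyclic pr'.
Proof.
move=> sub ac a h; apply: (ac a).
suff H b c : clos_trans _ pr' b c -> clos_trans _ pr b c by exact: H.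
elim=> {b c} [b c /sub|b c d _ bc _ cd]; first exact: t_step.
exact: t_trans bc cd.
Qed.

Lemma conflict_subset D A C : A `<=` D ->
  conflict A T C <-> conflict D T C /\ C `<=` A.
Proof.
move=> AD; split=> [[CA nC mC]|[[_ nC mC] CA]] //.
by split=> //; split=> // x /CA /AD.
Qed.

(** * Restriction and extension along a set dominating its crossing conflicts *)

Section DominatingSet.
Variables (D : set (fact Sg)) (pr : fact Sg -> fact Sg -> Prop) (A : set (fact Sg)).
Hypotheses (fD : finite_set D) (prP : priority_relation D T pr).
Hypotheses (AD : A `<=` D) (dA : dominates_crossing D pr A).

(** If [C] left [A], the fact [b] would dominate [a], against acyclicity. *)
Lemma priority_conflict_sub C a b :
  pr a b -> conflict D T C -> C a -> C b -> A b -> C `<=` A.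
Proof.
move=> ab cC Ca Cb Ab; have [//|bC] := dA cC Cb Ab.
have [ac _] := prP; have [eab|nab] := EM (a = b).
  by case: (ac a); apply: t_step; rewrite {2}eab.
by case: (acyclic_asym ac ab); exact: bC.
Qed.

Lemma priority_into a b : pr a b -> A b -> A a.
Proof.
move=> ab Ab; have [C [cC Ca Cb]] := prP.2 _ _ ab.
by apply: (priority_conflict_sub ab cC Ca Cb Ab).
Qed.

(** As [Q] lies in [R], a conflict inside the union contains some [b] in [P] but not in [R]. Either
    it stays within [A], or [b] dominates the rest of it, which then avoids [Q] outside [A]; both
    ways it lies in [P]. *)
Lemma consistent_glue R P Q : R `<=` D -> consistent T R ->
  P `<=` A -> consistent T P -> Q `<=` R ->
  (forall b x, (P `\` R) b -> (Q `\` A) x -> ~ pr b x) ->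
  Q `&` A `<=` P ->
  consistent T (P `|` Q).
Proof.
move=> RD cR PA cP QR PQ QP; apply: contrapT => nPQ.
have [|C [cC CPQ]] := conflict_exists fD _ nPQ.
  by move=> x [/PA /AD|/QR /RD].
have [_ nC _] := cC.
have [b [Cb Pb Rb]] : exists b, [/\ C b, P b & ~ R b].
  apply: contrapT => nb; apply: nC; apply: consistent_sub cR => x Cx.
  have [//|/QR//] := CPQ _ Cx; move=> Px; apply: contrapT => Rx.
  by apply: nb; exists x.
have [CA|bC] := dA cC Cb (PA _ Pb).
  apply: nC; apply: consistent_sub cP => x Cx.
  by have [//|Qx] := CPQ _ Cx; apply: QP; split=> //; exact: CA.
apply: nC; apply: consistent_sub cP => x Cx; apply: contrapT => Px.
have Qx : Q x by case: (CPQ _ Cx).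
apply: (PQ b x) => //; first by split=> // Ax; apply: Px; exact: QP.
by apply: bC => // xb; apply: Px; rewrite xb.
Qed.

Lemma PRep_setI R : PRep D T pr R -> PRep A T (restrict_rel A pr) (R `&` A).
Proof.
move=> /PRepE[RD cR nI]; apply/PRepE; split; first by move=> x [].
  by apply: consistent_sub cR => x [].
move=> [P [PA cP [b [[Pb Rb] bR]]]]; apply: nI.
have Rb' : ~ R b by move=> Rb'; apply: Rb; split=> //; exact: PA.
(* The other new facts of [P] are discarded: they could conflict with outer facts that [b] does not
   dominate. *)
pose P' := P `&` (R `|` [set b]).
pose Q := [set x | [/\ R x, ~ A x & ~ pr b x]].
exists (P' `|` Q); split.
- by move=> x [[/PA /AD]|[/RD]].
- apply: (@consistent_glue R) => //.
  + by move=> x [/PA].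
  + by apply: consistent_sub cP => x [].
  + by move=> x [].
  + by move=> c x [[Pc [//|->]] _] [[]].
  + by move=> x [[_ nAx _] /nAx].
- exists b; split; first by split=> //; left; split=> //; right.
  move=> a [Ra /not_orP[P'a Qa]]; have [Aa|Aa] := EM (A a).
    have [|] := bR a => //; split=> // Pa; apply: P'a; split=> //; by left.
  by apply: contrapT => ba; apply: Qa.
Qed.

Lemma GRep_setI R : GRep D T pr R -> GRep A T (restrict_rel A pr) (R `&` A).
Proof.
move=> /GRepE[RD cR nI]; apply/GRepE; split; first by move=> x [].
  by apply: consistent_sub cR => x [].
move=> [P [PA cP PR PI]]; apply: nI.
pose Q := [set x | [/\ R x, ~ A x & forall b, (P `\` R) b -> ~ pr b x]].
exists (P `|` Q); split.
- by move=> x [/PA /AD|[/RD]].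
- apply: (@consistent_glue R) => //.
  + by move=> x [].
  + by move=> b x Pb [[_ _ /(_ _ Pb)]].
  + by move=> x [[_ nAx _] /nAx].
- move=> PQR; apply: PR; rewrite -PQR; apply/seteqP; split=> x.
    by move=> Px; split; [left|exact: PA].
  by move=> [[//|[_ + _]]].
- move=> a [Ra /not_orP[Pa Qa]]; have [Aa|Aa] := EM (A a).
    have [|b [[Pb Rb] [Ab _ ba]]] := PI a; first by split=> // -[].
    by exists b; split=> //; split; [left|move=> Rb'; exact: Rb].
  apply: contrapT => nb; apply: Qa; split=> // b [Pb Rb] ba; apply: nb.
  by exists b; split=> //; split=> //; left.
Qed.

(** All of [R] is kept from the start; outer facts are then tried by increasing rank and added when
    consistent. A rejected fact is thus blocked by [R] and the retained facts of smaller rank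
    alone. *)
Lemma greedy_extension R : consistent T R -> R `<=` A ->
  exists f : fact Sg -> nat, exists R',
  [/\ forall a b, D a -> D b -> pr a b -> f a < f b,
      R' `<=` D, consistent T R', R' `&` A = R
    & forall b, D b -> ~ A b -> ~ R' b ->
        ~ consistent T (b |` (R `|` [set x | R' x /\ f x < f b]))].
Proof.
move=> cR RA; have [f [N [fN finj fpr]]] := acyclic_rank prP.1 fD.
suff [R' [R'D cR' RR' mR']] : exists R', [/\ R' `<=` D,
    consistent T R', R' `&` A = R & forall b, D b -> ~ A b -> ~ R' b -> f b < N ->
      ~ consistent T (b |` (R `|` [set x | R' x /\ f x < f b]))].
  by exists f, R'; split=> // b Db Ab Rb; apply: mR' => //; exact: fN.
(* The added bound on the ranks of retained outer facts is the invariant of the induction on [N]: by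
   stage [n], only ranks below [n] have been tried. *)
suff [R' [R'D cR' RR' _ mR']] : exists R', [/\ R' `<=` D,
    consistent T R', R' `&` A = R, forall x, R' x -> ~ A x -> f x < N &
    forall b, D b -> ~ A b -> ~ R' b -> f b < N ->
      ~ consistent T (b |` (R `|` [set x | R' x /\ f x < f b]))].
  by exists R'; split.
elim: N {fN} => [|n [S [SD cS SR Sn mS]]].
  exists R; split=> //; first by move=> x /RA /AD.
  - by rewrite setIidl.
  - by move=> x /RA.
have [[c [Dc Ac fc cSc]]|nc] :=
    EM (exists c, [/\ D c, ~ A c, f c = n & consistent T (c |` S)]).
  exists (c |` S); split=> //.
  - by move=> x [->|/SD].
  - by rewrite setIUl SR set1I memNset// set0U.
  - by move=> x [->|Sx Ax]; [rewrite fc|apply: leqW; exact: Sn].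
  - move=> b Db Ab /not_orP[bc Sb] fb.
    (* By injectivity [c] is the only fact of rank [n], so [b] was already rejected. *)
    have fbn : f b < n.
      rewrite ltn_neqAle -ltnS fb andbT; apply/eqP => fbn.
      by apply: bc; apply: finj => //; rewrite fc.
    apply: contra_not (mS b Db Ab Sb fbn); apply: consistent_sub.
    by move=> x [xb|[Rx|[Sx xb]]];
      [left|right; left|right; right; split=> //; right].
exists S; split=> // [x Sx Ax|b Db Ab Sb]; first by apply: leqW; exact: Sn.
rewrite ltnS leq_eqVlt => /orP[/eqP fb|]; last exact: mS.
apply: contra_not nc => cb; exists b; split=> //; apply: consistent_sub cb.
move=> x [->|Sx]; [by left|right].
have [Ax|Ax] := EM (A x); first by left; rewrite -SR.
by right; split=> //=; rewrite fb; exact: Sn.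
Qed.

(** Let [b] witness an improvement [P] of the greedy extension. If [b] is in [A], the trace of [P]
    on [A] improves [R]. Otherwise [P] contains [R] and all retained facts of rank below that of
    [b], since [b] dominates none of them; this contradicts the rejection of [b]. *)
Lemma PRep_extend R : PRep A T (restrict_rel A pr) R ->
  exists R', PRep D T pr R' /\ R = R' `&` A.
Proof.
move=> /PRepE[RA cR nI].
have [f [R' [fpr R'D cR' R'A mR']]] := greedy_extension cR RA.
exists R'; split=> //; apply/PRepE; split=> // -[P [PD cP [b [[Pb Rb] bR]]]].
have RR' x : R x -> R' x by rewrite -R'A => -[].
have [Ab|Ab] := EM (A b).
  apply: nI; exists (P `&` A); split; first by move=> x [].
    by apply: consistent_sub cP => x [].
  exists b; split; first by split=> // /RR'.
  move=> a [Ra Pa]; have Aa := RA _ Ra; split=> //; apply: bR.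
  by split; [exact: RR'|move=> Pa'; exact: Pa].
apply: (mR' b) => //; first exact: PD.
apply: consistent_sub cP => x [->//|[Rx|[Rx xb]]]; apply: contrapT => Px.
  apply: Ab; apply: (@priority_into b x); last exact: RA.
  by apply: bR; split=> //; exact: RR'.
have bx : pr b x by exact: bR.
by have := fpr _ _ (PD _ Pb) (R'D _ Rx) bx; rewrite ltnNge ltnW.
Qed.

(** Dominators of facts of [A] lie in [A], so an improvement not meeting [A] in [R] would yield one
    of [R]. Hence all new facts are outer ones. *)
Lemma GRep_extend R : GRep A T (restrict_rel A pr) R ->
  exists R', GRep D T pr R' /\ R = R' `&` A.
Proof.
move=> /GRepE[RA cR nI].
have [f [R' [fpr R'D cR' R'A mR']]] := greedy_extension cR RA.
exists R'; split=> //; apply/GRepE; split=> // -[P [PD cP PR' PI]].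
have RR' x : R x -> R' x by rewrite -R'A => -[].
have PA : P `&` A = R.
  apply: contrapT => PAR; apply: nI; exists (P `&` A); split=> //.
  - by apply: consistent_sub cP => x [].
  - move=> a [Ra Pa]; have Aa := RA _ Ra.
    have [|b [[Pb Rb] ba]] := PI a.
      by split; [exact: RR'|move=> Pa'; exact: Pa].
    have Ab := priority_into ba Aa.
    by exists b; split; [split=> // /RR'|split].
(* A new fact of least rank should have been chosen by the greedy procedure. *)
have new n b : (P `\` R') b -> f b <> n.
  elim/ltn_ind: n b => n IH b [Pb R'b] fb.
  have nA c : (P `\` R') c -> ~ A c.
    move=> [Pc R'c] Ac; apply: R'c; apply: RR'; rewrite -PA; by split.
  apply: (mR' b) => //; [exact: PD|exact: nA|].
  apply: consistent_sub cP => x [->//|[|[Rx xb]]]; first by rewrite -PA => -[].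
  (* A lost [x] of rank below that of [b] has a new dominator of still smaller rank, excluded by
     [IH]. *)
  apply: contrapT => Px; have [//|c [Pc cx]] := PI x.
  have := fpr _ _ (PD _ Pc.1) (R'D _ Rx) cx => fcx.
  by apply: (IH (f c) _ c Pc erefl); rewrite -fb; exact: ltn_trans xb.
have no b : ~ (P `\` R') b by move=> /new /(_ erefl).
apply: PR'; apply/seteqP; split=> x h; apply: contrapT => nx.
  exact: (no x).
by have [//|b [/no]] := PI x.
Qed.

(** A conflict justifying a pair of [pr'] inside [A] cannot leave [A], by domination and asymmetry;
    it is thus a conflict of the restriction. *)
Lemma completion_restrict pr' :
  completion D T pr pr' ->
  completion A T (restrict_rel A pr) (restrict_rel A pr').
Proof.
move=> [[ac' prC'] tot' sub']; have dA' := dominates_crossingS sub' dA.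
split=> [|a b nab [C [/(conflict_subset _ AD)[cC CA] Ca Cb]]|a b [Aa Ab /sub' ab]].
- split=> [|a b [Aa Ab ab]].
    by apply: acyclic_sub ac' => a b [].
  have [C [cC Ca Cb]] := prC' _ _ ab; exists C; split=> //.
  apply/(conflict_subset _ AD); split=> //.
  have [//|bC] := dA' _ _ cC Cb Ab; case: (acyclic_asym ac' ab); apply: bC => // eab.
  by apply: (ac' a); apply: t_step; rewrite {2}eab.
- have [|ab|ba] := tot' a b nab; first by exists C.
    by left; split=> //; exact: CA.
  by right; split=> //; exact: CA.
- by split.
Qed.

End DominatingSet.

(** * Completion-optimal repairs *)

Lemma CRep_setI D pr A R : finite_set D -> A `<=` D -> dominates_crossing D pr A ->
  CRep D T pr R -> CRep A T (restrict_rel A pr) (R `&` A).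
Proof.
move=> fD AD dA [pr' [cpr' gR]]; exists (restrict_rel A pr'); split.
  exact: (completion_restrict AD dA cpr').
have [_ _ sub'] := cpr'.
by apply: GRep_setI gR => //; exact: dominates_crossingS sub' dA.
Qed.

(** An injective rank refining [pr] orients every pair of facts sharing a conflict. *)
Lemma completion_exists D pr : finite_set D -> priority_relation D T pr ->
  exists pr', completion D T pr pr'.
Proof.
move=> fD [ac prC]; have [f [_ [_ finj fpr]]] := acyclic_rank ac fD.
pose co a b := exists C, [/\ conflict D T C, C a & C b].
exists (fun a b => co a b /\ f a < f b); split.
- split=> [a h|a b [//]].
  suff H b c : clos_trans _ (fun a b => co a b /\ f a < f b) b c -> f b < f c.
    by have := H _ _ h; rewrite ltnn.
  elim=> {b c} [b c []//|b c d _ bc _ cd]; exact: ltn_trans bc cd.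
- move=> a b nab co_ab; have [C [cC Ca Cb]] := co_ab; have [CD _ _] := cC.
  have [lt|lt|/finj eab] := ltngtP (f a) (f b); first by left.
    by right; split=> //; exists C.
  by case: nab; apply: eab; exact: CD.
- move=> a b ab; have [C [cC Ca Cb]] := prC _ _ ab; have [CD _ _] := cC.
  by split; [exists C|apply: fpr => //; exact: CD].
Qed.

(** [pr] steps may leave [A] but never enter it, and [s] steps stay in [A]; so a cycle lies inside
    [A], where [s] contains [pr], or outside, where only [pr] acts. *)
Lemma priority_union D pr A s : priority_relation D T pr -> A `<=` D ->
  dominates_crossing D pr A -> completion A T (restrict_rel A pr) s ->
  priority_relation D T (fun a b => pr a b \/ s a b).
Proof.
move=> prP AD dA [[acs sC] _ prs].
have sA a b : s a b -> A a /\ A b.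
  by move=> /sC[C [[CA _ _] Ca Cb]]; split; exact: CA.
split=> [a h|a b [/prP.2//|/sC[C [/(conflict_subset _ AD)[cC _] Ca Cb]]]];
  last by exists C.
have [ac _] := prP.
(* Nothing is claimed of a path leaving [A]: a cycle has both ends on the same side. *)
suff H b c : clos_trans _ (fun a b => pr a b \/ s a b) b c ->
    (A c -> A b /\ clos_trans _ s b c) /\ (~ A b -> ~ A c /\ clos_trans _ pr b c).
  by have [/(proj1 (H _ _ h))[_ /acs]//|/(proj2 (H _ _ h))[_ /ac]//] := EM (A a).
elim=> {b c} [b c [bc|bc]|b c d _ [bc1 bc2] _ [cd1 cd2]].
- split=> [Ac|Ab].
    have Ab := priority_into prP dA bc Ac.
    by split=> //; apply: t_step; exact: prs.
  split; last exact: t_step.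
  by move=> Ac; apply: Ab; exact: (priority_into prP dA bc Ac).
- have [Ab Ac] := sA _ _ bc; split=> // _; split=> //; exact: t_step.
- split=> [/cd1[/bc1[Ab bc] cd]|/bc2[/cd2[Ad cd] bc]]; split=> //.
    exact: t_trans bc cd.
  exact: t_trans bc cd.
Qed.

(** [s] and [pr] are merged and completed to [pr'], whose restriction to [A] is [s] again, so
    [GRep_extend] applies with [pr']. *)
Lemma CRep_extend D pr A R : finite_set D -> priority_relation D T pr ->
  A `<=` D -> dominates_crossing D pr A -> CRep A T (restrict_rel A pr) R ->
  exists R', CRep D T pr R' /\ R = R' `&` A.
Proof.
move=> fD prP AD dA [s [cs gR]].
have [pr' [prP' tot' sub']] := completion_exists fD (priority_union prP AD dA cs).
have prpr' a b : pr a b -> pr' a b by move=> ab; apply: sub'; left.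
have dA' := dominates_crossingS prpr' dA.
have [_ tots _] := cs.
(* [s] is total on [A], so an extra pair of [pr'] there would reverse a pair of [s], giving a
   cycle. *)
have restrictE a b : restrict_rel A pr' a b <-> s a b.
  split=> [[Aa Ab ab]|ab].
    have [C [cC Ca Cb]] := prP'.2 _ _ ab.
    have CA := priority_conflict_sub prP' dA' ab cC Ca Cb Ab.
    have nab : a <> b.
      by move=> eab; apply: (prP'.1 a); apply: t_step; rewrite {2}eab.
    have [|//|ba] := tots a b nab.
      by exists C; split=> //; apply/(conflict_subset _ AD).
    by case: (acyclic_asym prP'.1 ab); apply: sub'; right.
  have [[_ sC] _ _] := cs; have [C [[CA _ _] Ca Cb]] := sC _ _ ab.
  by split; [exact: CA|exact: CA|apply: sub'; right].
have eqs : restrict_rel A pr' = s.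
  by apply/funext => a; apply/funext => b; apply/propext; exact: restrictE.
have [|R' [gR' RR']] := GRep_extend fD prP' AD dA' (R := R).
  by rewrite eqs.
by exists R'; split=> //; exists pr'; split.
Qed.

End KnowledgeBaseTheory.

Unset Implicit Arguments.

Theorem theorem3 (Sg : signature) (D : set (fact Sg)) (T : set (sentence Sg))
    (pr : fact Sg -> fact Sg -> Prop) (X : optimality) (B : set (fact Sg)) :
  prioritized_kb D T pr -> B `<=` D ->
  let Br := Rw D T pr B in
  (forall R : set (fact Sg),
     XRep X D T pr R ->
     XRep X Br T (restrict_rel Br pr) (R `&` Br)) /\
  (forall R : set (fact Sg),
     XRep X Br T (restrict_rel Br pr) R ->
     exists R' : set (fact Sg), XRep X D T pr R' /\ R = R' `&` Br).
Proof.
move=> [[fD _] prP] BD Br.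
have BrD : Br `<=` D by exact: Rw_sub.
have dBr : @dominates_crossing Sg T D pr Br by exact: Rw_dominates_crossing.
case: X; split=> R /=.
- exact: PRep_setI.
- exact: PRep_extend.
- exact: GRep_setI.
- exact: GRep_extend.
- exact: CRep_setI.
- exact: CRep_extend.
Qed.
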